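(* Let $G^{(1)},G^{(2)}\in\mathbb{R}^{N\times N}$ have zero diagonals and let $\kappa\in[0,1]$. In any of the following cases, the multiplex network game with layers $G^{(1)},G^{(2)}$ and parameter $\kappa$ has a unique Nash equilibrium (for all admissible benefit functions and unit costs): 1. $I+G^{(1)}$ and $I+G^{(2)}$ are symmetric P-matrices. 2. $I+G^{(1)}$ and $I+G^{(2)}$ are strictly row diagonally dominant, i.e., $\sum_{j\neq i}|g^{(l)}_{ij}|<1$ for all $i$ and $l\in\{1,2\}$. 3. $I+G^{(1)}$ and $I+G^{(2)}$ are B-matrices, in the sense that $1+\sum_{j}g^{(l)}_{ij}>0$ and $\frac{1}{N}\bigl(1+\sum_{j\neq k}g^{(l)}_{ij}\bigr)>g^{(l)}_{ik}$ for all $i$, all $k\neq i$, and $l\in\{1,2\}$.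
   Context: A square real matrix is a P-matrix if all its principal minors (determinants of submatrices obtained by deleting a set of rows and the corresponding columns) are strictly positive. Multiplex network game: there are $N$ agents; agent $i$ chooses an effort $x_i\in\mathbb{R}_{\geq 0}$. The two layers are given by real $N\times N$ matrices $G^{(1)}=(g^{(1)}_{ij})$ and $G^{(2)}=(g^{(2)}_{ij})$ with zero diagonals (entries of arbitrary sign, not necessarily symmetric), and $\kappa\in[0,1]$. Agent $i$'s utility is $$u_i(\mathbf{x})=b_i\Bigl(x_i+\kappa\sum_{j=1}^N g^{(1)}_{ij}x_j+(1-\kappa)\sum_{j=1}^N g^{(2)}_{ij}x_j\Bigr)-c_ix_i,$$ where the benefit function $b_i:\mathbb{R}\to\mathbb{R}$ is twice differentiable, strictly increasing and strictly concave, and the unit cost is $c_i>0$; it is assumed that there is a (necessarily unique) $q_i\in\mathbb{R}$ with $b_i'(q_i)=c_i$ (this is what ''admissible'' means). Write $G^{\parallel}:=\kappa G^{(1)}+(1-\kappa)G^{(2)}$. A (pure) Nash equilibrium is a vector $\mathbf{x}^*\in\mathbb{R}^N_{\geq 0}$ such that each $x_i^*$ maximizes $u_i$ over $x_i\ge 0$ given the others; equivalently, $x_i^*=\max\{0,\,q_i-(G^{\parallel}\mathbf{x}^* )_i\}$ for all $i$. *)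

(* Defs.v *)
From HB Require Import structures.
From mathcomp Require Import all_boot all_order all_algebra.
From mathcomp Require Import all_classical all_reals all_analysis.
Set Implicit Arguments.
Unset Strict Implicit.
Unset Printing Implicit Defensive.
Import Order.TTheory GRing.Theory Num.Theory.
Import numFieldNormedType.Exports.
Local Open Scope ring_scope.

(* [S] lists the rows and columns that are kept. The empty minor is 1, so
   including [S = set0] adds no constraint. *)
Definition principal_minor (R : realType) (N : nat) (A : 'M[R]_N)
    (S : {set 'I_N}) : R :=
  \det (mxsub (@enum_val _ (mem S)) (@enum_val _ (mem S)) A).

Definition P_matrix (R : realType) (N : nat) (A : 'M[R]_N) : Prop :=
  forall S : {set 'I_N}, 0 < principal_minor A S.

Definition twice_differentiable (R : realType) (f : R -> R) : Prop :=
  (forall x : R, derivable f x 1) /\ (forall x : R, derivable (derive1 f) x 1).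

Definition strictly_increasing (R : realType) (f : R -> R) : Prop :=
  forall x y : R, x < y -> f x < f y.

Definition strictly_concave (R : realType) (f : R -> R) : Prop :=
  forall x y t : R, x != y -> 0 < t -> t < 1 ->
    t * f x + (1 - t) * f y < f (t * x + (1 - t) * y).

Definition admissible (R : realType) (b : R -> R) (c : R) : Prop :=
  [/\ twice_differentiable b, strictly_increasing b, strictly_concave b,
      0 < c & exists q : R, derive1 b q = c].

Definition utility (R : realType) (N : nat) (G1 G2 : 'M[R]_N) (kappa : R)
    (b : 'I_N -> R -> R) (c : 'I_N -> R) (i : 'I_N) (x : 'cV[R]_N) : R :=
  b i (x i 0 + kappa * (\sum_(j < N) G1 i j * x j 0)
             + (1 - kappa) * (\sum_(j < N) G2 i j * x j 0))
  - c i * x i 0.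

Definition deviate (R : realType) (N : nat) (x : 'cV[R]_N) (i : 'I_N) (y : R)
    : 'cV[R]_N :=
  \col_j (if j == i then y else x j 0).

Definition nash_equilibrium (R : realType) (N : nat) (G1 G2 : 'M[R]_N)
    (kappa : R) (b : 'I_N -> R -> R) (c : 'I_N -> R) (x : 'cV[R]_N) : Prop :=
  (forall i, 0 <= x i 0) /\
  (forall (i : 'I_N) (y : R), 0 <= y ->
     utility G1 G2 kappa b c i (deviate x i y) <= utility G1 G2 kappa b c i x).

Definition symmetric_P (R : realType) (N : nat) (A : 'M[R]_N) : Prop :=
  A^T = A /\ P_matrix A.

Definition strictly_row_diag_dominant (R : realType) (N : nat) (A : 'M[R]_N)
    : Prop :=
  forall i : 'I_N, \sum_(j < N | j != i) `|A i j| < `|A i i|.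

(* The B-matrix condition on [I + G], for [G] with zero diagonal. The second
   sum leaves out the entry [G i k] being compared; the usual definition
   compares it with the mean of the whole row. *)
Definition B_matrix_1D (R : realType) (N : nat) (G : 'M[R]_N) : Prop :=
  forall i : 'I_N,
    0 < 1 + \sum_(j < N) G i j /\
    forall k : 'I_N, k != i ->
      G i k < N%:R^-1 * (1 + \sum_(j < N | j != k) G i j).

Lemma strictly_row_diag_dominant_1D (R : realType) (N : nat) (G : 'M[R]_N) :
  (forall i, G i i = 0) ->
  strictly_row_diag_dominant (1%:M + G) <->
  (forall i : 'I_N, \sum_(j < N | j != i) `|G i j| < 1).
Proof.
move=> G0; split=> h i; move: (h i); rewrite !mxE eqxx G0 addr0 normr1;
  congr (_ < _); apply: eq_bigr => j ji;
  by rewrite !mxE eq_sym (negbTE ji) add0r.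
Qed.

(* Main.v *)
Require Import Defs.
From HB Require Import structures.
From mathcomp Require Import all_boot all_order all_algebra.
From mathcomp Require Import all_classical all_reals all_analysis.
From mathcomp Require Import ring lra.
Import Order.TTheory GRing.Theory Num.Theory.
Import numFieldNormedType.Exports.
Local Open Scope ring_scope.

(* Strict concavity makes [max 0 (q_i - (G x)_i)] the unique best response of
   agent [i], so Nash equilibria are the solutions of the linear complementarity
   problem with matrix [A = I + G] and vector [q]. If [A] reverses the signs of
   no nonzero vector ([x_i (A x)_i <= 0] for all [i] implies [x = 0]), this
   problem has at most one solution, because the difference of two solutions is
   sign-reversed. A solution is found by induction on the number of
   complementarity constraints: solve first with [x_i = 0]; if the slack at [i]
   is negative, solve instead with zero slack at [i], and nonreversal forces
   [x_i >= 0]. The three classes of matrices are replaced by convex classes of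
   sign-nonreversing matrices: positive definite, diagonally dominant, and those
   whose off-diagonal entries lie below a positive row mean. *)

(** * Principal minors as determinants of full-size matrices *)

(** Two block triangular matrices, each carrying one side as its determinant, are the products of
    the same two factors in opposite orders. *)
Lemma det_1DmulC (R : comNzRingType) (m n : nat) (U : 'M[R]_(m, n)) (V : 'M[R]_(n, m)) :
  \det (1%:M + U *m V) = \det (1%:M + V *m U).
Proof.
have E1 : block_mx (1%:M + U *m V) U 0 1%:M =
    block_mx 1%:M U (- V) 1%:M *m block_mx 1%:M 0 V 1%:M.
  by rewrite mulmx_block !mulmx1 !mul1mx !mulmx0 add0r addNr add0r.
have E2 : block_mx 1%:M U 0 (1%:M + V *m U) =
    block_mx 1%:M 0 V 1%:M *m block_mx 1%:M U (- V) 1%:M.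
  rewrite mulmx_block !mulmx1 !mul1mx !mul0mx !addr0 subrr.
  by rewrite addrC.
have := congr1 determinant E1; rewrite det_ublock det1 mulr1 => ->.
have := congr1 determinant E2; rewrite det_ublock det1 mul1r => ->.
by rewrite !det_mulmx mulrC.
Qed.

(** Full-size stand-in for the principal submatrix on [S], so that [S] can vary without changing the
    dimension. It is also the matrix of the system that prescribes [(A *m x) i 0] on [S] and [x i 0]
    elsewhere. *)
Definition mixed_rows {R : nzRingType} {N : nat} (A : 'M[R]_N) (S : {set 'I_N}) :
    'M[R]_N :=
  \matrix_(i, j) if i \in S then A i j else (i == j)%:R.

Lemma mulmx_mixed_rows (R : nzRingType) (N : nat) (A : 'M[R]_N) (S : {set 'I_N})
    (x : 'cV[R]_N) i :
  (mixed_rows A S *m x) i 0 = if i \in S then (A *m x) i 0 else x i 0.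
Proof.
rewrite !mxE; case: ifPn => iS.
  by apply: eq_bigr => j _; rewrite mxE iS.
rewrite (bigD1 i) //= mxE (negbTE iS) eqxx mul1r big1 ?addr0 // => j ji.
by rewrite mxE (negbTE iS) eq_sym (negbTE ji) mul0r.
Qed.

(** With [P] the matrix selecting the rows in [S], the left matrix is [1 + P^T *m (P *m (A - 1))]
    and the submatrix is [1 + (P *m (A - 1)) *m P^T]. *)
Lemma det_mixed_rows (R : comNzRingType) (N : nat) (A : 'M[R]_N) (S : {set 'I_N}) :
  \det (mixed_rows A S) =
  \det (mxsub (@enum_val _ (mem S)) (@enum_val _ (mem S)) A).
Proof.
set f := @enum_val _ (mem S).
pose P : 'M[R]_(#|S|, N) := rowsub f 1%:M.
have f_inj : injective f by apply: enum_val_inj.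
have -> : mxsub f f A = 1%:M + (P *m (A - 1%:M)) *m P^T.
  apply/matrixP => i j; rewrite -rowsubE !mxE (bigD1 (f j)) //= !mxE eqxx mulr1.
  rewrite (inj_eq f_inj) big1 ?addr0 1?addrC ?subrK // => k kj.
  by rewrite !mxE [f j == k]eq_sym (negbTE kj) mulr0.
rewrite -det_1DmulC; congr (\det _); apply/matrixP => i j.
rewrite -rowsubE !mxE; case: ifPn => iS.
  rewrite (bigD1 (enum_rank_in iS i)) //= !mxE /f enum_rankK_in // eqxx mul1r.
  rewrite big1 ?addr0 1?addrC ?subrK // => k kj; rewrite !mxE.
  case: eqP => [e|]; last by rewrite mul0r.
  by case/eqP: kj; apply: f_inj; rewrite /f enum_rankK_in.
rewrite big1 ?addr0 // => k _; rewrite !mxE; case: eqP => [e|]; last by rewrite mul0r.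
by case/negP: iS; rewrite -e; exact: (enum_valP k).
Qed.

Lemma unitmx_mulmx_inj (F : fieldType) (N : nat) (A : 'M[F]_N) :
  (forall x : 'cV[F]_N, A *m x = 0 -> x = 0) -> A \in unitmx.
Proof.
move=> A_inj; rewrite unitmxE unitfE -det_tr; apply/det0P => -[v v0 vA].
have vT0 : v^T = 0 by apply: A_inj; rewrite -[A]trmxK -trmx_mul vA trmx0.
by case/eqP: v0; rewrite -[v]trmxK vT0 trmx0.
Qed.

Lemma convex_gt0 (R : realFieldType) (t a b : R) :
  0 <= t <= 1 -> 0 < a -> 0 < b -> 0 < t * a + (1 - t) * b.
Proof. by move=> /andP[t0 t1] a0 b0; nra. Qed.

(** * Linear complementarity with sign-nonreversing matrices *)

Section ordered.
Context {R : realFieldType} {N : nat}.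
Implicit Types (A : 'M[R]_N) (q x y : 'cV[R]_N).

Definition sign_nonreversing A : Prop :=
  forall x, (forall i, x i 0 * (A *m x) i 0 <= 0) -> x = 0.

Definition complementary A q x i : Prop :=
  [/\ 0 <= x i 0, q i 0 <= (A *m x) i 0
    & x i 0 * ((A *m x) i 0 - q i 0) = 0].

(** A kernel vector [x] has [x i 0] or [(A *m x) i 0] equal to zero at every [i], so it is
    sign-reversed. *)
Lemma mixed_rows_unit A (S : {set 'I_N}) :
  sign_nonreversing A -> mixed_rows A S \in unitmx.
Proof.
move=> snrA; apply: unitmx_mulmx_inj => x Mx0; apply: snrA => i.
have := mulmx_mixed_rows R N A S x i; rewrite Mx0 mxE.
by case: ifP => _ <-; rewrite ?mul0r ?mulr0.
Qed.

Lemma complementary_unique A q x y : sign_nonreversing A ->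
  (forall i, complementary A q x i) -> (forall i, complementary A q y i) -> x = y.
Proof.
move=> snrA hx hy; apply/eqP; rewrite -subr_eq0; apply/eqP/snrA => i.
rewrite mulmxBr; have [x0 wx cx] := hx i; have [y0 wy cy] := hy i.
(* By [cx] and [cy], the product is minus [x] times the slack of [y], minus [y] times the slack of
   [x]. *)
rewrite !mxE in wx wy cx cy x0 y0 *; nra.
Qed.

(** Arbitrary [C] and [F] let the induction on [#|C|] freeze the removed coordinate either at zero
    or at zero slack. *)
Lemma complementary_exists_pivot A q (C F : {set 'I_N}) : sign_nonreversing A ->
  exists x, forall i, if i \in C then complementary A q x i
    else if i \in F then (A *m x) i 0 = q i 0 else x i 0 = 0.
Proof.
move=> snrA; have [k] := ubnP #|C|; elim: k C F => // k IH C F ltk.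
have [C0|[i iC]] := set_0Vmem C.
  pose r : 'cV[R]_N := \col_i if i \in F then q i 0 else 0.
  exists (invmx (mixed_rows A F) *m r) => i; rewrite C0 inE.
  have := mulmx_mixed_rows R N A F (invmx (mixed_rows A F) *m r) i.
  by rewrite mulKVmx ?mixed_rows_unit // mxE; case: ifP.
have ltC : (#|C :\ i| < k)%N by rewrite (cardsD1 i C) iC in ltk.
have [x hx] := IH (C :\ i) (F :\ i) ltC.
have xi0 : x i 0 = 0 by have := hx i; rewrite !inE eqxx.
have [wxi|wxi] := leP (q i 0) ((A *m x) i 0).
  exists x => j; have := hx j; rewrite !inE; have [-> _|//] := eqVneq j i.
  by rewrite iC; split; rewrite ?xi0 ?mul0r.
have [y hy] := IH (C :\ i) (i |: F) ltC.
have wyi : (A *m y) i 0 = q i 0 by have := hy i; rewrite !inE eqxx.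
have yi0 : 0 <= y i 0.
  (* [y - x] reverses the signs of all coordinates but [i]. *)
  rewrite leNgt; apply/negP => yi_lt0.
  have yx0 : y - x = 0.
    apply: snrA => j; rewrite mulmxBr [X in X * _]mxE [X in _ * X]mxE.
    rewrite [X in _ + X]mxE [X in _ * (_ + X)]mxE.
    (* At [i] the product is [y i 0] times the positive number [q i 0 - (A *m x) i 0], so [yi_lt0]
       makes it negative as well. *)
    have [->|ji] := eqVneq j i; first by rewrite xi0 wyi; nra.
    have := hx j; have := hy j; rewrite !inE (negbTE ji) /=.
    case: (j \in C) => [[y0 wy cy] [x0 wx cx]|]; first by nra.
    by case: (j \in F) => -> ->; rewrite !subrr ?mulr0 ?mul0r.
  by move: yi_lt0; rewrite (subr0_eq yx0) xi0 ltxx.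
exists y => j; have := hy j; rewrite !inE; have [-> _|//] := eqVneq j i.
by rewrite iC; split; rewrite ?wyi ?subrr ?mulr0.
Qed.

Lemma complementary_exists A q : sign_nonreversing A ->
  exists x, forall i, complementary A q x i.
Proof.
move=> snrA; have [x hx] := complementary_exists_pivot A q [set: 'I_N]%SET
  finset.set0 snrA.
by exists x => i; have := hx i; rewrite inE.
Qed.

(** * Positive definite matrices and Sylvester's criterion *)

Definition positive_definite A : Prop :=
  forall x, x != 0 -> 0 < (x^T *m A *m x) 0 0.

Lemma quadratic_formE A x : (x^T *m A *m x) 0 0 = \sum_i x i 0 * (A *m x) i 0.
Proof. by rewrite -mulmxA mxE; apply: eq_bigr => i _; rewrite mxE. Qed.

Lemma positive_definite_sign_nonreversing A :
  positive_definite A -> sign_nonreversing A.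
Proof.
move=> pdA x hx; apply/eqP; apply/negPn/negP => /pdA.
by rewrite quadratic_formE ltNge sumr_le0 // => i _; apply: hx.
Qed.

Lemma positive_definite_convex A B (t : R) : 0 <= t <= 1 ->
  positive_definite A -> positive_definite B ->
  positive_definite (t *: A + (1 - t) *: B).
Proof.
move=> t01 pdA pdB x x0.
rewrite mulmxDr mulmxDl -!scalemxAr -!scalemxAl mxE [X in X + _]mxE [X in _ + X]mxE.
by apply: convex_gt0; rewrite ?pdA ?pdB.
Qed.

(** Subtracting [w] times the unit row from row [i] gives a matrix [K] that kills [y], and [y] is
    nonzero since [y i 0 = 1]. Hence [\det K = 0], and linearity of the determinant in row [i] gives
    the formula. *)
Lemma det_mixed_rows_setD1 A (S : {set 'I_N}) i y : i \in S ->
  mixed_rows A (S :\ i) *m y = delta_mx i 0 ->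
  \det (mixed_rows A S) = (A *m y) i 0 * \det (mixed_rows A (S :\ i)).
Proof.
move=> iS My; set w := (A *m y) i 0.
have yi : y i 0 = 1.
  have := mulmx_mixed_rows R N A (S :\ i) y i.
  by rewrite My !inE eqxx /= => <-; rewrite mxE !eqxx.
pose K : 'M[R]_N := \matrix_(j, k)
  (mixed_rows A S j k - (if j == i then w * (j == k)%:R else 0)).
have rowsK j : j != i -> row j (mixed_rows A S) = row j K.
  by move=> ji; apply/rowP => k; rewrite !mxE (negbTE ji) subr0.
have detK : \det K = \det (mixed_rows A S) - w * \det (mixed_rows A (S :\ i)).
  rewrite -mulNr -[\det (mixed_rows A S)]mul1r.
  apply: (@determinant_multilinear _ _ _ _ _ i).
  - by apply/rowP => k; rewrite !mxE !inE eqxx /= mul1r mulNr.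
  - apply/matrixP => j k; rewrite !mxE [lift i j == i]eq_sym.
    by rewrite (negbTE (neq_lift _ _)) subr0.
  - apply/matrixP => j k; rewrite !mxE !inE [lift i j == i]eq_sym.
    by rewrite (negbTE (neq_lift _ _)) /= subr0.
suff detK0 : \det K = 0 by apply/eqP; rewrite -subr_eq0 -detK detK0.
apply/eqP; have [//|detKN0] := eqVneq (\det K) 0.
have Kunit : K \in unitmx by rewrite unitmxE unitfE.
suff Ky : K *m y = 0.
  by move: yi; rewrite -[y](mulKmx Kunit) Ky mulmx0 mxE => /eqP; rewrite eq_sym oner_eq0.
apply/colP => j; rewrite [RHS]mxE.
have -> : (K *m y) j 0 = (mixed_rows A S *m y) j 0 - (if j == i then w else 0).
  rewrite !mxE -[if _ then _ else _](_ : \sum_k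
    (if j == i then w * (j == k)%:R else 0) * y k 0 = _).
    by rewrite -sumrB; apply: eq_bigr => k _; rewrite !mxE mulrBl.
  case: eqP => [->|_]; last by rewrite big1 // => k _; rewrite mul0r.
  rewrite (bigD1 i) //= eqxx mulr1 yi mulr1 big1 ?addr0 // => k ki.
  by rewrite eq_sym (negbTE ki) mulr0 mul0r.
rewrite mulmx_mixed_rows; have [->|ji] := eqVneq j i; first by rewrite iS subrr.
have := mulmx_mixed_rows R N A (S :\ i) y j; rewrite My !inE ji mxE (negbTE ji) /=.
by case: (j \in S) => <-; rewrite subr0.
Qed.

(* Sylvester's criterion, by induction on the support of the vector. *)
Lemma positive_definite_minors A : A^T = A ->
  (forall S : {set 'I_N}, 0 < \det (mixed_rows A S)) -> positive_definite A.
Proof.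
move=> symA detA.
suff PD (F : {set 'I_N}) x : (forall i, i \notin F -> x i 0 = 0) ->
    x != 0 -> 0 < (x^T *m A *m x) 0 0.
  by move=> x; apply: (PD [set: 'I_N]%SET) => i; rewrite inE.
have [k] := ubnP #|F|; elim: k F x => // k IH F x ltk suppx x0.
have [F0|[i iF]] := set_0Vmem F.
  by case/eqP: x0; apply/colP => i; rewrite suppx ?F0 ?inE // mxE.
have ltF : (#|F :\ i| < k)%N by rewrite (cardsD1 i F) iF in ltk.
(* [y] is supported in [F], has [i]-th entry 1, and [A *m y] vanishes on the rest of [F]. *)
pose y := invmx (mixed_rows A (F :\ i)) *m delta_mx i 0 : 'cV[R]_N.
have My : mixed_rows A (F :\ i) *m y = delta_mx i 0.
  by rewrite mulKVmx // unitmxE unitfE gt_eqF.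
have yE j : (delta_mx i 0 : 'cV[R]_N) j 0 =
    if j \in F :\ i then (A *m y) j 0 else y j 0.
  by rewrite -My mulmx_mixed_rows.
have yi : y i 0 = 1 by have := yE i; rewrite !inE eqxx mxE !eqxx.
have Ay j : j \in F -> j != i -> (A *m y) j 0 = 0.
  by move=> jF ji; have := yE j; rewrite !inE ji jF mxE (negbTE ji).
have y_out j : j \notin F -> y j 0 = 0.
  move=> jF; have ji : j != i by apply: contraNneq jF => ->.
  by have := yE j; rewrite !inE (negbTE jF) andbF mxE (negbTE ji).
(* This pivot is the quotient of the minors on [F] and [F :\ i]. *)
have w0 : 0 < (A *m y) i 0.
  have := detA F; rewrite (det_mixed_rows_setD1 _ _ _ _ iF My).
  by rewrite pmulr_lgt0.
(* Removing the [y] component clears coordinate [i]. The remainder [u] lives on [F :\ i], where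
   [A *m y] is zero, so [u] and [y] are orthogonal for [A] and the quadratic form splits. *)
have [u uE] : exists u, u = x - x i 0 *: y by exists (x - x i 0 *: y).
have u_out j : j \notin F :\ i -> u j 0 = 0.
  rewrite !inE negb_and negbK => /predU1P[->|jF].
    by rewrite uE 3!mxE yi mulr1 subrr.
  by rewrite uE 3!mxE (suppx j jF) (y_out j jF) mulr0 subrr.
have uAy : (u^T *m A *m y) 0 0 = 0.
  rewrite -mulmxA mxE big1 // => j _; rewrite [u^T _ _]mxE.
  have [jF|jF] := boolP (j \in F :\ i); last by rewrite u_out // mul0r.
  by move: jF; rewrite !inE => /andP[ji jF]; rewrite Ay // mulr0.
have yAu : (y^T *m A *m u) 0 0 = 0.
  have -> : y^T *m A *m u = (u^T *m A *m y)^T.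
    by rewrite !trmx_mul trmxK symA mulmxA.
  by rewrite mxE.
have yAy : (y^T *m A *m y) 0 0 = (A *m y) i 0.
  rewrite quadratic_formE (bigD1 i) //= yi mul1r big1 ?addr0 // => j ji.
  have [jF|jF] := boolP (j \in F); first by rewrite Ay // mulr0.
  by rewrite y_out // mul0r.
have -> : (x^T *m A *m x) 0 0 = x i 0 ^+ 2 * (A *m y) i 0 + (u^T *m A *m u) 0 0.
  have xE : x = x i 0 *: y + u by rewrite uE addrC subrK.
  have xTE : x^T = x i 0 *: y^T + u^T by rewrite [in LHS]xE linearD linearZ.
  rewrite xTE [X in _ *m X]xE !mulmxDl !mulmxDr -!scalemxAl -!scalemxAr.
  have addE (B C : 'M[R]_1) : (B + C) 0 0 = B 0 0 + C 0 0 by rewrite mxE.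
  have scaleE a (B : 'M[R]_1) : (a *: B) 0 0 = a * B 0 0 by rewrite mxE.
  by rewrite !(addE, scaleE) uAy yAu yAy !mulr0 addr0 add0r mulrA -expr2.
have [xi0|xi0] := eqVneq (x i 0) 0.
  have ux : u = x by rewrite uE xi0 scale0r subr0.
  rewrite xi0 expr0n mul0r add0r; apply: (IH (F :\ i) u) => //.
  by rewrite ux.
have [->|u0] := eqVneq u 0.
  rewrite mulmx0 [X in _ + X]mxE addr0 mulr_gt0 //.
  by rewrite lt_neqAle eq_sym sqrf_eq0 xi0 sqr_ge0.
by rewrite addr_gt0 ?(IH (F :\ i) u) // mulr_gt0 // lt_neqAle eq_sym sqrf_eq0 xi0 sqr_ge0.
Qed.

(** * Diagonal dominance and the row mean condition *)

(** At a coordinate where [|x_i|] is maximal, the diagonal term of [x_i (A x)_i] outweighs all the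
    others together. *)
Lemma diag_dominant_sign_nonreversing A :
  (forall i, \sum_(j < N | j != i) `|A i j| < A i i) -> sign_nonreversing A.
Proof.
move=> ddA x hx; have [//|/eqP x0] := eqVneq x 0.
have [i0 _|none] := pickP (fun _ : 'I_N => true); last first.
  by apply/colP => i; have := none i.
have [i _ /(_ _ isT) imax] := @arg_maxP _ _ _ i0 xpredT (fun i => `|x i 0|) isT.
have {}imax j : `|x j 0| <= `|x i 0| by exact: imax.
have xi_gt0 : 0 < `|x i 0|.
  rewrite normr_gt0; apply/eqP => xi0; apply: x0; apply/colP => j; rewrite mxE.
  by apply/eqP; rewrite -normr_le0 -(normr0 R) -xi0 imax.
have := hx i; rewrite leNgt => /negP[]; rewrite mxE (bigD1 i) //=.
set s := \sum_(_ < _ | _) _.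
have sle : `|s| <= `|x i 0| * \sum_(j < N | j != i) `|A i j|.
  rewrite mulr_sumr; apply: le_trans (ler_norm_sum _ _ _) _; apply: ler_sum => j _.
  by rewrite normrM mulrC ler_wpM2r // imax.
set d := \sum_(_ < _ | _) _ in sle.
have xs : - (x i 0 * s) <= `|x i 0| * `|s| by rewrite -normrM -normrN ler_norm.
have x2 : `|x i 0| ^+ 2 = x i 0 ^+ 2 by rewrite real_normK ?num_real.
have := ler_wpM2l (ltW xi_gt0) sle.
have : 0 < `|x i 0| ^+ 2 * (A i i - d) by rewrite mulr_gt0 ?exprn_gt0 ?subr_gt0 ?ddA.
rewrite mulrA -expr2 x2; lra.
Qed.

(* At a coordinate [i] where [x] is maximal, [(A x)_i] is the row mean times
   [\sum_j x_j] plus [\sum_(j != i) (mean - A i j) (x_i - x_j)]; replacing [x]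
   by [- x] if necessary makes the first term nonnegative. *)
Lemma B_matrix_sign_nonreversing A :
  (forall i, 0 < \sum_j A i j) ->
  (forall i k, k != i -> A i k < N%:R^-1 * \sum_j A i j) ->
  sign_nonreversing A.
Proof.
move=> sumA BA.
suff B_ge0 x : 0 <= \sum_j x j 0 ->
    (forall i, x i 0 * (A *m x) i 0 <= 0) -> x = 0.
  move=> x hx; have [/B_ge0 ->//|sx] := leP 0 (\sum_j x j 0).
  apply/eqP; rewrite -oppr_eq0; apply/eqP/B_ge0.
    under eq_bigr do rewrite mxE.
    by rewrite sumrN oppr_ge0 ltW.
  by move=> i; rewrite mulmxN 2!mxE mulrNN.
move=> sx hx; have [//|/eqP x0] := eqVneq x 0.
have [i0 _|none] := pickP (fun _ : 'I_N => true); last first.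
  by apply/colP => i; have := none i.
have [i _ /(_ _ isT) imax] := @arg_maxP _ _ _ i0 xpredT (fun i => x i 0) isT.
have {}imax j : x j 0 <= x i 0 by exact: imax.
(* If the maximum were at most zero, the nonnegative sum would force every entry to vanish. *)
have xi_gt0 : 0 < x i 0.
  rewrite ltNge; apply/negP => xi_le0; apply: x0; apply/colP => j; rewrite [RHS]mxE.
  have xle0 k : x k 0 <= 0 by apply: le_trans xi_le0; apply: imax.
  apply/eqP; rewrite -oppr_eq0.
  have : \sum_k - x k 0 == 0.
    by rewrite eq_le sumr_ge0 ?sumrN ?oppr_le0 ?sx // => k _; rewrite oppr_ge0.
  rewrite psumr_eq0 => [/allP/(_ j)|k _]; last by rewrite oppr_ge0.
  by rewrite mem_index_enum => /(_ isT).
have N_gt0 : 0 < N%:R :> R by rewrite ltr0n (leq_ltn_trans _ (ltn_ord i)).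
have := hx i; rewrite leNgt => /negP[]; rewrite pmulr_rgt0 //.
set m := N%:R^-1 * \sum_j A i j.
have m_gt0 : 0 < m by rewrite mulr_gt0 ?invr_gt0.
have -> : (A *m x) i 0 =
    m * \sum_j x j 0 + \sum_(j < N | j != i) (m - A i j) * (x i 0 - x j 0).
  have -> : \sum_(j < N | j != i) (m - A i j) * (x i 0 - x j 0) =
      \sum_j (m - A i j) * (x i 0 - x j 0).
    by rewrite [RHS](bigD1 i) //= subrr mulr0 add0r.
  have -> : \sum_j (m - A i j) * (x i 0 - x j 0) =
      \sum_j (m * x i 0 - A i j * x i 0 - m * x j 0 + A i j * x j 0).
    by apply: eq_bigr => j _; ring.
  rewrite !big_split /= !sumrN -!mulr_sumr -mulr_suml sumr_const card_ord mxE.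
  have -> : m * (x i 0 *+ N) = (\sum_j A i j) * x i 0.
    by rewrite -mulr_natl /m mulrACA mulVf ?mul1r ?gt_eqF.
  by ring.
have term_ge0 j : j != i -> 0 <= (m - A i j) * (x i 0 - x j 0).
  by move=> ji; rewrite mulr_ge0 ?subr_ge0 ?imax // ltW // BA.
(* If the sum is zero and the second term vanishes too, [x] is constant and equal to [x i 0 > 0],
   which contradicts the zero sum. *)
move: sx; rewrite le_eqVlt => /predU1P[sx0|sx]; last first.
  by apply: ltr_wpDr; [apply: sumr_ge0|rewrite mulr_gt0].
rewrite -sx0 mulr0 add0r lt_neqAle sumr_ge0 // andbT eq_sym.
rewrite psumr_eq0 //; apply/negP => /allP all0.
suff xE j : x j 0 = x i 0.
  move: sx0; rewrite (eq_bigr _ (fun j _ => xE j)) sumr_const card_ord => /eqP.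
  by rewrite eq_sym mulrn_eq0 (gt_eqF xi_gt0) orbF -(pnatr_eq0 R) (gt_eqF N_gt0).
have [->//|ji] := eqVneq j i.
have := all0 j; rewrite mem_index_enum ji => /(_ isT) /=; rewrite mulf_eq0.
by rewrite (gt_eqF (_ : 0 < m - A i j)) ?subr_gt0 ?BA //= subr_eq0 => /eqP.
Qed.
End ordered.

(** * Concave benefits and best responses *)

(** Concavity puts each difference quotient from [q] towards [v], with step in (0,1), above
    [b v - b q]; the limit gives the weak inequality. Applying it at the midpoint of [u] and [q]
    makes it strict. *)
Lemma strictly_concave_tangent (R : realType) (b : R -> R) (q u : R) :
  derivable b q 1 -> strictly_concave b -> u != q ->
  b u < b q + derive1 b q * (u - q).
Proof.
move=> db cb.
suff le_tangent v : b v <= b q + derive1 b q * (v - q).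
  move=> uq; have := cb u q 2^-1 uq; have := le_tangent (2^-1 * u + (1 - 2^-1) * q).
  by move=> h /(_ ltac:(lra) ltac:(lra)); lra.
have [->|vq] := eqVneq v q; first by rewrite subrr mulr0 addr0.
have dfb := (derivable1_diffP b q).1 db.
have -> : derive1 b q * (v - q) = 'D_(v - q) b q.
  rewrite derive1E !deriveE // -[v - q in RHS]mulr1.
  by rewrite -[(v - q) * 1]/((v - q) *: (1 : R)) linearZ /= mulrC.
rewrite -lerBlDl; have /cvg_dnbhs_at_right := @diff_derivable _ _ _ _ _ (v - q) dfb.
rewrite -/('D_(v - q) b q) => slope.
rewrite leNgt; apply/negP => lt_slope.
have /= /(_ _) near_lt := cvgr_lt _ slope _ lt_slope.
have [h [[h0 h1]]] : exists h : R, (0 < h /\ h < 1) /\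
    h^-1 * (b (h * (v - q) + q) - b q) < b v - b q.
  apply: (@filter_ex _ ((0 : R)^'+)%classic); near=> h; split; last by near: h.
  by split; near: h; [exact: nbhs_right_gt | exact: nbhs_right_lt].
rewrite ltr_pdivrMl // ltNge => /negP; apply.
have := cb v q h vq h0 h1; have -> : h * v + (1 - h) * q = h * (v - q) + q by ring.
lra.
Unshelve. all: by end_near.
Qed.

Lemma best_response_unique_max (R : realType) (b : R -> R) (c q t y : R) :
  admissible b c -> derive1 b q = c -> 0 <= y -> y != Num.max 0 (q - t) ->
  b (y + t) - c * y < b (Num.max 0 (q - t) + t) - c * Num.max 0 (q - t).
Proof.
move=> [[db _] _ cb c0 _] bq y0.
have tangent u : u != q -> b u < b q + c * (u - q).
  by rewrite -bq; exact: strictly_concave_tangent.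
have [tq|qt] := leP t q.
  rewrite max_r ?subr_ge0 // subrK => yq.
  have /tangent : y + t != q by apply: contraNneq yq => <-; rewrite addrK.
  lra.
rewrite max_l ?subr_le0 ?(ltW qt) // add0r mulr0 subr0 => yN0.
have y_gt0 : 0 < y by rewrite lt_neqAle eq_sym yN0.
have s_gt0 : 0 < y + t - q by lra.
have ytq : y + t != q by rewrite -subr_eq0 gt_eqF.
have lt_u := tangent _ ytq.
(* Here [q < t < y + t], and this ratio is the weight of [y + t] when [t] is written as a convex
   combination of [y + t] and [q]. *)
have l0 : 0 < (t - q) / (y + t - q) by rewrite divr_gt0 // subr_gt0.
have l1 : (t - q) / (y + t - q) < 1 by rewrite ltr_pdivrMr // mul1r; lra.
have := cb (y + t) q _ ytq l0 l1.
set l := (t - q) / _ in l0 l1 *.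
have lE : l * (y + t - q) = t - q by rewrite /l divfK ?gt_eqF.
have -> : l * (y + t) + (1 - l) * q = t by rewrite -[RHS](subrK q) -lE; ring.
have : 0 < (1 - l) * (b q + c * (y + t - q) - b (y + t)).
  by rewrite mulr_gt0 ?subr_gt0.
have : c * (l * (y + t - q)) = c * (t - q) by rewrite lE.
lra.
Qed.

(** * Convex combinations of the two layers *)

Lemma symmetric_P_positive_definite (R : realType) (N : nat) (A : 'M[R]_N) :
  symmetric_P A -> positive_definite A.
Proof.
move=> [symA PA]; apply: positive_definite_minors => // S.
by rewrite det_mixed_rows; exact: PA.
Qed.

Lemma diag_dominant_convex_sign_nonreversing (R : realType) (N : nat)
    (G1 G2 : 'M[R]_N) (t : R) : 0 <= t <= 1 ->
  (forall i, G1 i i = 0) -> (forall i, G2 i i = 0) ->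
  strictly_row_diag_dominant (1%:M + G1) ->
  strictly_row_diag_dominant (1%:M + G2) ->
  sign_nonreversing (t *: (1%:M + G1) + (1 - t) *: (1%:M + G2)).
Proof.
move=> t01 G10 G20; have /andP[t0 t1] := t01.
move=> /(strictly_row_diag_dominant_1D G10) dd1 /(strictly_row_diag_dominant_1D G20) dd2.
apply: diag_dominant_sign_nonreversing => i.
rewrite !mxE eqxx G10 G20 !addr0 !mulr1 addrC subrK.
apply: (@le_lt_trans _ _ (t * \sum_(j < N | j != i) `|G1 i j|
                          + (1 - t) * \sum_(j < N | j != i) `|G2 i j|)); last first.
  have := dd2 i; rewrite -subr_gt0 => dd2i; have := dd1 i; rewrite -subr_gt0 => dd1i.
  by have := convex_gt0 _ _ _ _ t01 dd1i dd2i; lra.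
rewrite !mulr_sumr -big_split; apply: ler_sum => j ji /=.
rewrite !mxE eq_sym (negbTE ji) !add0r; apply: le_trans (ler_normD _ _) _.
by rewrite !normrM (ger0_norm t0) [`|1 - t|]ger0_norm ?subr_ge0.
Qed.

(** The sum in [B_matrix_1D] omits [G i k]. If that entry is positive, restoring it only raises the
    mean; otherwise positivity of the row mean suffices. *)
Lemma B_matrix_1D_row_mean (R : realType) (N : nat) (G : 'M[R]_N) i :
  G i i = 0 -> B_matrix_1D G ->
  0 < \sum_j (1%:M + G) i j /\
  forall k, k != i -> (1%:M + G) i k < N%:R^-1 * \sum_j (1%:M + G) i j.
Proof.
move=> Gii BG; have [sumG meanG] := BG i.
have -> : \sum_j (1%:M + G) i j = 1 + \sum_j G i j.
  under eq_bigr do rewrite !mxE.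
  rewrite big_split /= (bigD1 i) //= eqxx big1 ?addr0 // => j ji.
  by rewrite eq_sym (negbTE ji).
split=> // k ki; rewrite !mxE eq_sym (negbTE ki) add0r.
have N_gt0 : 0 < N%:R^-1 :> R by rewrite invr_gt0 ltr0n (leq_ltn_trans _ (ltn_ord i)).
have := meanG k ki; rewrite [\sum_j G i j](bigD1 k) //= in sumG *.
have [Gik|Gik] := leP (G i k) 0; last by nra.
by move=> _; apply: le_lt_trans Gik _; rewrite mulr_gt0.
Qed.

Lemma B_matrix_convex_sign_nonreversing (R : realType) (N : nat)
    (G1 G2 : 'M[R]_N) (t : R) : 0 <= t <= 1 ->
  (forall i, G1 i i = 0) -> (forall i, G2 i i = 0) ->
  B_matrix_1D G1 -> B_matrix_1D G2 ->
  sign_nonreversing (t *: (1%:M + G1) + (1 - t) *: (1%:M + G2)).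
Proof.
move=> t01 G10 G20 BG1 BG2.
set A1 := 1%:M + G1; set A2 := 1%:M + G2.
have AE i j : (t *: A1 + (1 - t) *: A2) i j = t * A1 i j + (1 - t) * A2 i j.
  by rewrite mxE [X in X + _]mxE [X in _ + X]mxE.
have sumE i : \sum_j (t *: A1 + (1 - t) *: A2) i j =
    t * \sum_j A1 i j + (1 - t) * \sum_j A2 i j.
  by under eq_bigr do rewrite AE; rewrite big_split /= !mulr_sumr.
apply: B_matrix_sign_nonreversing => i => [|k ki]; rewrite sumE ?AE;
  have [s1 m1] := B_matrix_1D_row_mean R N G1 i (G10 i) BG1;
  have [s2 m2] := B_matrix_1D_row_mean R N G2 i (G20 i) BG2.
  exact: convex_gt0.
have := m2 k ki; rewrite -subr_gt0 => m2k; have := m1 k ki; rewrite -subr_gt0 => m1k.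
by have := convex_gt0 _ _ _ _ t01 m1k m2k; lra.
Qed.

(** * Nash equilibria as complementarity solutions *)

Lemma max0_complementary (R : realFieldType) (x t q : R) :
  x = Num.max 0 (q - t) <-> [/\ 0 <= x, q <= x + t & x * (x + t - q) = 0].
Proof.
split=> [->|[x0 wx /eqP]].
  by have [h|h] := leP (q - t) 0; split; lra.
by rewrite mulf_eq0 => /orP[|] /eqP h; have [h'|h'] := leP (q - t) 0; lra.
Qed.

Lemma nash_equilibrium_complementary (R : realType) (N : nat) (G1 G2 : 'M[R]_N)
    (kappa : R) (b : 'I_N -> R -> R) (c : 'I_N -> R) (q x : 'cV[R]_N) :
  (forall i, G1 i i = 0) -> (forall i, G2 i i = 0) ->
  (forall i, admissible (b i) (c i)) -> (forall i, derive1 (b i) (q i 0) = c i) ->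
  nash_equilibrium G1 G2 kappa b c x <->
  forall i, complementary (kappa *: (1%:M + G1) + (1 - kappa) *: (1%:M + G2)) q x i.
Proof.
move=> G10 G20 adm bq.
pose t i := kappa * (\sum_j G1 i j * x j 0) + (1 - kappa) * (\sum_j G2 i j * x j 0).
have AxE i : ((kappa *: (1%:M + G1) + (1 - kappa) *: (1%:M + G2)) *m x) i 0 =
    x i 0 + t i.
  rewrite mulmxDl -!scalemxAl !mulmxDl !mul1mx mxE [X in X + _]mxE [X in _ + X]mxE.
  rewrite [X in _ * X]mxE [X in _ + _ * X]mxE.
  by rewrite [X in kappa * (_ + X)]mxE [X in (1 - kappa) * (_ + X)]mxE /t; ring.
(* The zero diagonal makes the contribution of the network independent of the agent's own effort. *)
have sumE (G : 'M[R]_N) i y : G i i = 0 ->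
    \sum_j G i j * deviate x i y j 0 = \sum_j G i j * x j 0.
  move=> Gii; apply: eq_bigr => j _; rewrite mxE.
  by case: eqP => [->|//]; rewrite Gii !mul0r.
have devE i y : utility G1 G2 kappa b c i (deviate x i y) = b i (y + t i) - c i * y.
  by rewrite /utility !sumE // mxE eqxx addrA.
have uE i : utility G1 G2 kappa b c i x = b i (x i 0 + t i) - c i * x i 0.
  by rewrite /utility addrA.
have compE i : complementary (kappa *: (1%:M + G1) + (1 - kappa) *: (1%:M + G2)) q x i
    <-> x i 0 = Num.max 0 (q i 0 - t i).
  by rewrite max0_complementary /complementary AxE.
split=> [[x0 nash] i|comp].
  apply/compE/eqP/negPn/negP => xN.
  have := best_response_unique_max _ _ _ (q i 0) (t i) _ (adm i) (bq i) (x0 i) xN.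
  by rewrite ltNge -uE -devE nash // le_max lexx.
split=> [i|i y y0]; first by have [] := comp i.
rewrite devE uE; have /compE -> := comp i.
have [->//|yN] := eqVneq y (Num.max 0 (q i 0 - t i)).
by apply/ltW/best_response_unique_max.
Qed.

Theorem proposition2 (R : realType) (N : nat) (G1 G2 : 'M[R]_N) (kappa : R)
    (hG1 : forall i : 'I_N, G1 i i = 0) (hG2 : forall i : 'I_N, G2 i i = 0)
    (hkappa0 : 0 <= kappa) (hkappa1 : kappa <= 1)
    (hcases :
      [\/ symmetric_P (1%:M + G1) /\ symmetric_P (1%:M + G2),
          strictly_row_diag_dominant (1%:M + G1) /\
            strictly_row_diag_dominant (1%:M + G2)
        | B_matrix_1D G1 /\ B_matrix_1D G2])
    (b : 'I_N -> R -> R) (c : 'I_N -> R)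
    (hadm : forall i : 'I_N, admissible (b i) (c i)) :
  exists! x : 'cV[R]_N, nash_equilibrium G1 G2 kappa b c x.
Proof.
have /boolp.choice[q bq] i : exists q : R, derive1 (b i) q = c i by have [] := hadm i.
have bqE i : derive1 (b i) ((\col_i q i : 'cV_N) i 0) = c i by rewrite mxE.
have nashE x := nash_equilibrium_complementary R N G1 G2 kappa b c (\col_i q i) x
  hG1 hG2 hadm bqE.
have kappa01 : 0 <= kappa <= 1 by rewrite hkappa0.
have snr : sign_nonreversing (kappa *: (1%:M + G1) + (1 - kappa) *: (1%:M + G2)).
  case: hcases => [[sP1 sP2]|[dd1 dd2]|[B1 B2]].
  - apply/positive_definite_sign_nonreversing/positive_definite_convex => //;
      exact: symmetric_P_positive_definite.
  - exact: diag_dominant_convex_sign_nonreversing.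
  - exact: B_matrix_convex_sign_nonreversing.
have [x hx] := complementary_exists _ (\col_i q i) snr.
exists x; split=> [|y /nashE hy]; first exact/nashE.
exact: complementary_unique snr hx hy.
Qed.
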